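(* Let $\mathcal A=\mathcal A(\alpha)\subset\mathbb P^\ell$ be a hyperplane arrangement with $n$ hyperplanes and defining polynomial $Q=\prod_{i=1}^n\alpha_i$, let $2\le k\le \ell$, and let $H_0=\mathbb V(\alpha_0)$ be a hyperplane in rank $k+1$ general linear position with respect to $\mathcal A$. For $\lambda_1,\dots,\lambda_n\in\mathbb K$ put $$f=\sum_{i=1}^n\lambda_i\frac{Q}{\alpha_i},$$ and define $\beta:\{1,\dots,n\}\to V^*$ by $\beta_i=\alpha_i+\lambda_i\alpha_0$. Then $f\in J^{[k]}_{\mathcal A}$ if and only if $\beta$ is a weak perspective representation of $\mathcal M(\alpha)$ from $H_0$ up to rank $k+1$.
   Context: $\mathbb K$ is a field of characteristic zero, $V=\mathbb K^{\ell+1}$, $\mathbb P^\ell=\mathbb P(V)$, $S=\mathbb K[x_0,\dots,x_\ell]$. A hyperplane arrangement $\mathcal A=\mathcal A(\alpha)$ is given by a map $\alpha:\{1,\dots,n\}\to V^*$, $i\mapsto\alpha_i$, whose values are nonzero linear forms defining pairwise distinct hyperplanes $H_i=\mathbb V(\alpha_i)\subset\mathbb P^\ell$. $\mathcal M(\alpha)$ is the linear matroid on $\{1,\dots,n\}$ of the vectors $\alpha_1,\dots,\alpha_n$. A flat is identified with the linear subspace of $\mathbb P^\ell$ that is the intersection of its hyperplanes; its rank is its codimension (the empty subspace has codimension $\ell+1$). Truncation: $\mathcal N^{[k]}$ is the matroid whose independent sets are the independent sets of $\mathcal N$ of size at most $k$. Weak order: $\mathcal N\ge\mathcal M$ (same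 ground set) if every dependent set of $\mathcal N$ is dependent in $\mathcal M$. A map $\beta:\{1,\dots,n\}\to V^*$ is a weak representation of $\mathcal M(\alpha)$ up to rank $k$ if $\mathcal M(\alpha)^{[k]}\ge\mathcal M(\beta)^{[k]}$. A hyperplane $H_0$ is in rank $k$ general linear position with respect to $\mathcal A$ if no nonempty flat of $\mathcal A$ of rank at most $k$ is contained in $H_0$ (in particular, for $k\ge1$, $H_0\notin\mathcal A$). The maps $\alpha,\beta$ are perspective from $H_0=\mathbb V(\alpha_0)$ (with $H_0$ in neither arrangement) if $\mathbb V(\alpha_j)\cap H_0=\mathbb V(\beta_j)\cap H_0$ for all $j$; maps of the form $\beta_j=\alpha_j+\lambda_j\alpha_0$ always have this property. A weak perspective representation of $\mathcal M(\alpha)$ from $H_0$ up to rank $k$, where $H_0$ is in rank $k$ general linear position with respect to $\mathcal A(\alpha)$, is a weak representation $\beta$ of $\mathcal M(\alpha)$ up to rank $k$ that is perspective to $\alpha$ from $H_0$. The Jacobian ideal is $J_{\mathcal A}=\langle \partial Q/\partial x_0,\dots,\partial Q/\partial x_\ell\rangle\subset S$. The codimension-$k$ saturation $J^{[k]}_{\mathcal A}$ is the intersection of all primary components of $J_{\mathcal A}$ (in a primary decomposition) whose associated primes have codimension (height) at most $k$; this is independent of the decomposition (an empty intersection is $S$). *)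

(* Defs.v *)
From HB Require Import structures.
From mathcomp Require Import all_boot all_order all_algebra.
From mathcomp Require Import boolp classical_sets.
From mathcomp Require Export mpoly.

Set Implicit Arguments.
Unset Strict Implicit.
Unset Printing Implicit Defensive.

Import GRing.Theory.
Local Open Scope ring_scope.

Section Matroid.
Variable n : nat.
Implicit Types M N : {set {set 'I_n}}.

(* A matroid on 'I_n is represented by its family of independent sets. *)

Definition truncation M (k : nat) : {set {set 'I_n}} :=
  [set X in M | (#|X| <= k)%N].

Definition weak_order_ge N M : Prop :=
  forall X : {set 'I_n}, X \notin N -> X \notin M.

Definition matroid_rank M (X : {set 'I_n}) : nat :=
  \max_(Y in M | Y \subset X) #|Y|.

Definition matroid_flat M (F : {set 'I_n}) : Prop :=
  forall j : 'I_n, j \notin F ->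
    (matroid_rank M F < matroid_rank M (j |: F))%N.

End Matroid.

Notation dual K l := 'Hom('rV[K]_l.+1, K^o).

Section Arrangement.
Variables (K : fieldType) (l n : nat).

(* Linear subspaces of P^l are given by the corresponding subspaces of K^(l+1);
   the empty one is 0%VS, of codimension l+1. *)
Definition codim (W : {vspace 'rV[K]_l.+1}) : nat := (l.+1 - \dim W)%N.

Implicit Types (a : dual K l) (alpha beta : 'I_n -> dual K l).

Definition is_arrangement alpha : Prop :=
  (forall i, alpha i != 0) /\ injective (fun i => lker (alpha i)).

(* Independence of the family (alpha i)_(i in X), so repetitions count. *)
Definition linear_matroid alpha : {set {set 'I_n}} :=
  [set X : {set 'I_n} | free [seq alpha i | i <- enum X]].

Definition flat_space alpha (F : {set 'I_n}) : {vspace 'rV[K]_l.+1} :=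
  (\bigcap_(i in F) lker (alpha i))%VS.

Definition general_linear_position (k : nat) a alpha : Prop :=
  forall F : {set 'I_n}, matroid_flat (linear_matroid alpha) F ->
    flat_space alpha F != 0%VS -> (codim (flat_space alpha F) <= k)%N ->
    ~~ (flat_space alpha F <= lker a)%VS.

Definition weak_representation (k : nat) alpha beta : Prop :=
  weak_order_ge (truncation (linear_matroid alpha) k)
                (truncation (linear_matroid beta) k).

Definition perspective a alpha beta : Prop :=
  [/\ forall j, lker a != lker (alpha j),
      forall j, lker a != lker (beta j)
    & forall j, (lker (alpha j) :&: lker a)%VS =
                (lker (beta j) :&: lker a)%VS].

Definition weak_perspective_representation (k : nat) a alpha beta : Prop :=
  [/\ general_linear_position k a alpha,
      weak_representation k alpha beta
    & perspective a alpha beta].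

Definition linform a : {mpoly K[l.+1]} :=
  \sum_(j < l.+1) a (delta_mx 0 j) *: 'X_j.

Definition defining_poly alpha : {mpoly K[l.+1]} := \prod_i linform (alpha i).

(* The quotient Q / alpha_i. *)
Definition defining_poly_div alpha (i : 'I_n) : {mpoly K[l.+1]} :=
  \prod_(j | j != i) linform (alpha j).

Definition jacobian_ideal alpha : set {mpoly K[l.+1]} :=
  fun p => exists c : 'I_l.+1 -> {mpoly K[l.+1]},
    p = \sum_j c j * (defining_poly alpha)^`M(j).

End Arrangement.

Section Saturation.
Variable R : comNzRingType.
Implicit Types I J P : set R.

(* idealr_closed includes properness. *)
Definition is_prime_ideal P : Prop :=
  idealr_closed (mem P) /\ prime_idealr_closed (mem P).

Definition is_primary_ideal I : Prop :=
  idealr_closed (mem I) /\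
  forall u v : R, I (u * v) -> I u \/ exists m : nat, I (v ^+ m).

Definition radical I : set R := fun u => exists m : nat, I (u ^+ m).

(* Every strict chain of primes C 0 < ... < C m = P has length m <= k. *)
Definition height_le (P : set R) (k : nat) : Prop :=
  forall (m : nat) (C : 'I_m.+1 -> set R),
    (forall i, is_prime_ideal (C i)) ->
    (forall i j : 'I_m.+1, (i < j)%N -> (C i `<` C j)%classic) ->
    C ord_max = P -> (m <= k)%N.

(* The empty decomposition (m = 0) is that of the unit ideal. *)
Definition primary_decomposition J (m : nat) (D : 'I_m -> set R) : Prop :=
  (forall i, is_primary_ideal (D i)) /\ forall u, J u <-> forall i, D i u.

(* The choice of the decomposition is immaterial; over a noetherian ring one
   exists by the Lasker-Noether theorem. *)
Definition codim_saturation J (k : nat) : set R :=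
  fun u => exists (m : nat) (D : 'I_m -> set R),
    primary_decomposition J D /\
    forall i, height_le (radical (D i)) k -> D i u.

End Saturation.

(* Main.v *)
Require Import Defs.
From HB Require Import structures.
From mathcomp Require Import all_boot all_order all_algebra.
From mathcomp Require Import boolp classical_sets.

Set Implicit Arguments.
Unset Strict Implicit.
Unset Printing Implicit Defensive.

Import Order.TTheory GRing.Theory.
Local Open Scope ring_scope.

(* Both sides say that for every flat X of rank at most k there is a vector v
   with lambda_i = alpha_i(v) for all i in X.

   If this holds, let P be the radical of a primary component D of J of height
   at most k. The hyperplanes containing V(P) are those of a flat X of rank at
   most ht P <= k, and f minus the derivative of Q along v is a multiple of
   Q_X, the product of the alpha_i, i in X. As Q lies in J and Q / Q_X outside P,
   Q_X lies in D.

   Conversely, if f is in the saturation then f g = sum_j c_j dQ/dx_j for some g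
   not vanishing identically on X, because I(X) has height at most k and so
   contains no component of larger height. On H_i only the i-th term of this
   relation survives, whence lambda_i g = alpha_i(c) on H_i; evaluating at a
   point of X where g does not vanish gives v.

   For the matroids, alpha_0 is independent of the forms in any flat of rank at
   most k + 1 and less than l + 1, so a relation between the beta_i splits into
   the same relation between the alpha_i and between the lambda_i. *)

(** * Primary decomposition in polynomial rings *)

(** Repeatedly take an index at which [u] is least on the tail after the previous choice. *)
Lemma monotone_subsequence (u : nat -> nat) :
  exists phi : nat -> nat, {homo phi : i j / (i < j)%N} /\
    {homo u \o phi : i j / (i <= j)%N}.
Proof.
have argmin a : exists b, (a <= b)%N /\ forall c, (a <= c)%N -> (u b <= u c)%N.
  have ex : exists v, `[< exists2 b, (a <= b)%N & u b = v >].
    by exists (u a); apply/asboolP; exists a.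
  case: (ex_minnP ex) => v /asboolP[b ab ub] minv.
  by exists b; split=> // c ac; rewrite ub; apply/minv/asboolP; exists c.
have [g gP] := choice argmin.
pose phi := fix phi i := if i is j.+1 then g (phi j).+1 else g 0%N.
have phiS i : (phi i < phi i.+1)%N by have [] := gP (phi i).+1.
exists phi; split; first exact: homo_ltn ltn_trans phiS.
apply: (homo_leq leqnn leq_trans) => i /=.
case: i => [|i]; first by have [_ ->] := gP 0%N.
have [_] := gP (phi i).+1; apply.
by apply: leq_trans (phiS i) _; apply: ltnW; apply: phiS.
Qed.

(** Extracting a monotone subsequence for one coordinate after another makes every exponent
    nondecreasing along [phi]. *)
Lemma dickson n (u : nat -> 'X_{1..n}) :
  exists i j : nat, (i < j)%N /\ (u i <= u j)%MM.
Proof.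
suff [phi [phi_lt phi_mono]] : exists phi : nat -> nat,
    {homo phi : i j / (i < j)%N} /\ forall x, x \in enum 'I_n ->
    {homo (fun i => u (phi i) x) : i j / (i <= j)%N}.
  exists (phi 0%N), (phi 1%N); split; first exact: phi_lt.
  by apply/mnm_lepP => x; apply: phi_mono; rewrite ?mem_enum.
elim: (enum 'I_n) => [|x s [phi [phi_lt phi_mono]]]; first by exists id; split=> // x; rewrite in_nil.
have [psi [psi_lt psi_mono]] := monotone_subsequence (fun i => u (phi i) x).
exists (phi \o psi); split=> [i j ij /=|y]; first exact/phi_lt/psi_lt.
rewrite inE => /orP[/eqP->|ys]; first exact: psi_mono.
move=> i j ij /=; apply: phi_mono => //.
by move: ij; rewrite leq_eqVlt => /predU1P[->//|/psi_lt/ltnW].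
Qed.

(** * Ideals, primes and radicals of primary ideals *)

Section Ideals.
Variable R : comNzRingType.
Implicit Types (I J P D : set R) (u v : R).

(** Unlike [idealr_closed], this admits the unit ideal, which the Jacobian ideal can be: for [n = 1]
    the derivatives of [Q] are constants, not all zero. *)
Definition is_ideal I : Prop :=
  I 0 /\ forall a u v, I u -> I v -> I (a * u + v).

Lemma idealr_closedP I : idealr_closed (mem I) <-> is_ideal I /\ ~ I 1.
Proof.
split=> [[I0 I1 IS]|[[I0 IS] I1]].
  split; last by move/mem_set; apply/negP.
  split=> [|a u v Iu Iv]; first by rewrite inE in I0.
  by have := IS a u v (mem_set Iu) (mem_set Iv); rewrite inE.
split; [exact: mem_set | by apply/negP => /set_mem |].
by move=> a u v; rewrite !inE; apply: IS.
Qed.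

Lemma is_prime_idealP P : is_prime_ideal P <->
  [/\ is_ideal P, ~ P 1 & forall u v, P (u * v) -> P u \/ P v].
Proof.
split=> [[/idealr_closedP[IP P1] prP]|[IP P1 prP]].
  split=> // u v /mem_set/prP/orP[]; rewrite inE; tauto.
split; first exact/idealr_closedP.
move=> u v; rewrite !inE => /prP[Pu|Pv]; apply/orP; [left|right]; exact: mem_set.
Qed.

Section IdealTheory.
Variable I : set R.
Hypothesis idI : is_ideal I.

Lemma is_ideal0 : I 0. Proof. by case: idI. Qed.

Lemma is_idealD u v : I u -> I v -> I (u + v).
Proof. by move=> Iu Iv; rewrite -[u]mul1r; apply: idI.2. Qed.

Lemma is_idealMl a u : I u -> I (a * u).
Proof. by move=> Iu; rewrite -[_ * _]addr0; apply: idI.2 => //; exact: is_ideal0. Qed.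

Lemma is_idealMr a u : I u -> I (u * a).
Proof. by rewrite mulrC; exact: is_idealMl. Qed.

Lemma is_idealN u : I u -> I (- u).
Proof. by rewrite -mulN1r; exact: is_idealMl. Qed.

Lemma is_idealB u v : I u -> I v -> I (u - v).
Proof. by move=> Iu Iv; apply/is_idealD/is_idealN. Qed.

Lemma is_idealDr u v : I u -> I (u + v) -> I v.
Proof. by move=> Iu Iuv; rewrite -[v](addKr u) addrC; apply: is_idealB. Qed.

Lemma is_ideal_sum (T : Type) (r : seq T) (Q : pred T) (F : T -> R) :
  (forall i, Q i -> I (F i)) -> I (\sum_(i <- r | Q i) F i).
Proof. by move=> QF; apply: big_ind => //; [exact: is_ideal0 | exact: is_idealD]. Qed.

End IdealTheory.

Lemma prime_exp P u m : is_prime_ideal P -> P (u ^+ m) -> P u.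
Proof.
case/is_prime_idealP=> _ P1 prP; elim: m => [/P1//|m IHm].
by rewrite exprS => /prP[].
Qed.

Lemma prime_prod P (T : eqType) (r : seq T) (Q : pred T) (F : T -> R) :
  is_prime_ideal P -> P (\prod_(i <- r | Q i) F i) ->
  exists i, [/\ i \in r, Q i & P (F i)].
Proof.
case/is_prime_idealP=> _ P1 prP; elim: r => [|i r IHr].
  by rewrite big_nil => /P1.
rewrite big_cons; have rS j : j \in r -> j \in i :: r.
  by rewrite inE orbC => ->.
case: ifP => [Qi|_ /IHr[j [/rS]]]; last by exists j.
case/prP=> [Pi|/IHr[j [/rS]]]; last by exists j.
by exists i; rewrite mem_head.
Qed.

Lemma radical_prime D : is_primary_ideal D -> is_prime_ideal (radical D).
Proof.
case=> /idealr_closedP[idD D1] prD; apply/is_prime_idealP; split.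
- split=> [|a u v [i Du] [j Dv]]; first by exists 1%N; exact: is_ideal0.
  exists (i + j)%N; rewrite exprDn; apply: is_ideal_sum => // -[m /= mij] _.
  rewrite -mulr_natr; apply: is_idealMr => //.
  (* In each binomial term either the exponent [m] of [v] is at least [j], or that of [u] is at
     least [i]. *)
  have [jm|mj] := leqP j m.
    by rewrite -(subnK jm) exprD mulrA; apply: is_idealMl.
  have im : (i <= i + j - m)%N by rewrite -addnBA ?leq_addr// ltnW.
  rewrite exprMn -[X in u ^+ X](subnK im) exprD.
  by apply: is_idealMr => //; do 2 apply: is_idealMl => //.
- by case=> m; rewrite expr1n.
- move=> u v [m]; rewrite exprMn => /prD[Du|[q Dv]]; [left|right].
    by exists m.
  by exists (m * q)%N; rewrite exprM.
Qed.

End Ideals.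

(** * Ascending chains of ideals and the Lasker-Noether theorem *)

Section Noetherian.
Variables (K : fieldType) (n : nat).
Implicit Types I J : set {mpoly K[n]}.

Lemma mlead_minimal (E : set {mpoly K[n]}) p : E p ->
  exists2 q, E q & forall r, E r -> ~~ (mlead r < mlead q)%O.
Proof.
elim/mleadrect: p => p IHp Ep.
have [[q [Eq qp]]|noq] := pselect (exists q, E q /\ (mlead q < mlead p)%O).
  exact: IHp qp Eq.
by exists p => // r Er; apply/negP => rp; apply: noq; exists r.
Qed.

(** Hilbert's basis theorem. Were all inclusions strict, pick [p i] in [I i.+1] outside [I i] with
    least leading monomial. By Dickson's lemma that of some [p i] divides that of a later [p j], and
    reducing [p j] by [p i] contradicts minimality. *)
Lemma mpoly_acc (I : nat -> set {mpoly K[n]}) :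
  (forall i, is_ideal (I i)) -> (forall i, (I i `<=` I i.+1)%classic) ->
  exists i, (I i.+1 `<=` I i)%classic.
Proof.
move=> idI IS; apply: contrapT => /forallNP noI.
have Imono : forall i j, (i <= j)%N -> (I i `<=` I j)%classic.
  move=> i j /subnK<-; elim: (j - i)%N => // d IHd.
  by apply: subset_trans IHd _; rewrite addSn; apply: IS.
have /choice[p pP] i : exists p, (I i.+1 p /\ ~ I i p) /\
    forall q, I i.+1 q /\ ~ I i q -> ~~ (mlead q < mlead p)%O.
  have /existsNP[q /not_implyP Iq] := noI i.
  by have [r Ir minr] := @mlead_minimal (fun q => I i.+1 q /\ ~ I i q) q Iq; exists r.
have [i [j [ij le_ij]]] := dickson (fun i => mlead (p i)).
have p0 s : p s != 0.
  by apply/eqP => ps0; have [[_]] := pP s; rewrite ps0; case; exact: is_ideal0.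
(* [h] is the multiple of [p i] with the leading term of [p j]. It lies in [I j], so [p j - h] still
   lies in [I j.+1] outside [I j]. *)
pose a := (p j)@_(mlead (p j)) / (p i)@_(mlead (p i)).
pose h := a *: 'X_[mlead (p j) - mlead (p i)] * p i.
have [[Ij Nj] minj] := pP j.
have Ih : I j h.
  by apply: is_idealMl => //; apply: (Imono i.+1) => //; have [[]] := pP i.
have Nq : ~ I j (p j - h).
  by move=> Iq; apply: Nj; rewrite -(subrK h (p j)); apply: is_idealD.
have /negP[] := minj (p j - h) (conj (is_idealB (idI _) Ij (IS j _ Ih)) Nq).
have lead_X : mlead ('X_[mlead (p j) - mlead (p i)] : {mpoly K[n]}) =
              (mlead (p j) - mlead (p i))%MM by rewrite mleadXm.
have X0 : ('X_[mlead (p j) - mlead (p i)] : {mpoly K[n]}) != 0.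
  by rewrite -mleadc_eq0 lead_X mcoeffX eqxx oner_eq0.
have a0 : a != 0 by rewrite mulf_neq0 ?invr_eq0 ?mleadc_eq0.
have lead_h : mlead h = mlead (p j).
  by rewrite /h mleadM ?scaler_eq0 ?negb_or ?a0 ?X0 // mleadZ // lead_X submK.
rewrite lt_neqAle; apply/andP; split; last first.
  by rewrite (le_trans (mleadB_le _ _)) // lead_h joinxx.
apply: contra_not_neq Nq => lead_q; suff -> : p j - h = 0 by exact: is_ideal0.
apply/eqP; rewrite -mleadc_eq0 lead_q mcoeffB -[X in _ - h@_X]lead_h.
rewrite /h mleadcM_proper ?mulf_neq0 ?mleadc_eq0 ?scaler_eq0 ?negb_or ?a0 //.
rewrite mleadZ // lead_X mcoeffZ mcoeffX eqxx mulr1 /a divfK ?subrr //.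
by rewrite mleadc_eq0.
Qed.

Definition ideal_adjoin I (a : {mpoly K[n]}) : set {mpoly K[n]} :=
  fun p => exists r, I (p - r * a).

Lemma ideal_adjoin_ideal I a : is_ideal I -> is_ideal (ideal_adjoin I a).
Proof.
move=> idI; split; first by exists 0; rewrite mul0r subr0; exact: is_ideal0.
move=> b u v [r Ir] [s Is]; exists (b * r + s).
have -> : b * u + v - (b * r + s) * a = b * (u - r * a) + (v - s * a).
  by rewrite mulrDl mulrBr mulrA opprD addrACA.
exact: idI.2.
Qed.

Lemma sub_ideal_adjoin I a : (I `<=` ideal_adjoin I a)%classic.
Proof. by move=> p Ip; exists 0; rewrite mul0r subr0. Qed.

Lemma mem_ideal_adjoin I a : is_ideal I -> ideal_adjoin I a a.
Proof. by move=> idI; exists 1; rewrite mul1r subrr; exact: is_ideal0. Qed.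

(** Take [u * v] in [I] with neither [u] nor any power of [v] in [I]. Once the colon ideals of the
    powers of [v] agree at [m] and [m.+1], [I] is the intersection of [I + (u)] and
    [I + (v ^+ m)]. *)
Lemma not_primary_reducible I : is_ideal I -> ~ I 1 -> ~ is_primary_ideal I ->
  exists A B, [/\ is_ideal A, is_ideal B, (I `<` A)%classic, (I `<` B)%classic
    & forall p, I p <-> A p /\ B p].
Proof.
move=> idI I1 NI.
have [u [v [Iuv Iu Iv]]] : exists u v, [/\ I (u * v), ~ I u & forall m, ~ I (v ^+ m)].
  apply: contrapT => no_uv; apply: NI; split; first exact/idealr_closedP.
  move=> u v Iuv; apply: contrapT => /not_orP[Iu Iv]; apply: no_uv.
  by exists u, v; split=> // m Ivm; apply: Iv; exists m.
pose colon m : set {mpoly K[n]} := fun p => I (p * v ^+ m).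
have [||m stab] := @mpoly_acc colon.
- move=> m; split; first by rewrite /colon mul0r; exact: is_ideal0.
  by move=> a p q Ip Iq; rewrite /colon mulrDl -mulrA; apply: idI.2.
- by move=> m p Ip; rewrite /colon exprSr mulrA; apply: is_idealMr.
exists (ideal_adjoin I u), (ideal_adjoin I (v ^+ m)); split.
- exact: ideal_adjoin_ideal.
- exact: ideal_adjoin_ideal.
- split; first exact: sub_ideal_adjoin.
  by move/(_ u (mem_ideal_adjoin u idI)).
- split; first exact: sub_ideal_adjoin.
  by move/(_ _ (mem_ideal_adjoin (v ^+ m) idI)); exact: Iv.
move=> p; split=> [Ip|[[r Ir] [s Is]]]; first by split; exact: sub_ideal_adjoin.
(* Both [p * v] and [(p - s * v ^+ m) * v] lie in [I], hence so does [s * v ^+ m.+1]; stationarity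
   removes one factor [v]. *)
have Isv : I (s * v ^+ m).
  apply: stab; rewrite /colon exprSr mulrA.
  rewrite -[_ * v](subrK (p * v)) -mulrBl; apply: is_idealD => //.
    by apply: is_idealMr => //; rewrite -opprB; apply: is_idealN.
  rewrite -(subrK (r * u * v) (p * v)) -mulrBl; apply: is_idealD => //.
    exact: is_idealMr.
  by rewrite -mulrA; apply: is_idealMl.
by rewrite -(subrK (s * v ^+ m) p); apply: is_idealD.
Qed.

(** Decompositions of [A] and [B] concatenate to one of their intersection, so an ideal without
    decomposition lies strictly inside another such ideal; iterating violates the chain
    condition. *)
Lemma lasker_noether I : is_ideal I ->
  exists m (D : 'I_m -> set {mpoly K[n]}), primary_decomposition I D.
Proof.
pose dec J := exists m (D : 'I_m -> set {mpoly K[n]}), primary_decomposition J D.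
move=> idI; rewrite -/(dec I); apply: contrapT => NdecI.
pose bad := {J | is_ideal J /\ ~ dec J}.
have step (J : bad) : exists A : bad, (sval J `<` sval A)%classic.
  case: J => J [idJ NJ] /=.
  have J1 : ~ J 1.
    move=> J1; apply: NJ; exists 0%N, (fun _ => setT); split=> [[]//|u].
    by split=> // _; rewrite -[u]mulr1; apply: is_idealMl.
  have [|A [B [idA idB JA JB JAB]]] := not_primary_reducible idJ J1.
    move=> prJ; apply: NJ; exists 1%N, (fun _ => J); split=> // u.
    by split=> [//|]; apply; exact: ord0.
  have [NA|/contrapT[p [C [prC CA]]]] := pselect (~ dec A).
    by exists (exist _ A (conj idA NA)).
  have [NB|/contrapT[q [D [prD DB]]]] := pselect (~ dec B).
    by exists (exist _ B (conj idB NB)).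
  case: NJ; exists (p + q)%N.
  exists (fun i => match split i with inl a => C a | inr b => D b end).
  split=> [i|u]; first by case: splitP.
  rewrite JAB CA DB; split=> [[HC HD] i|H]; first by case: splitP.
  split=> i; first by have := H (lshift q i); case: splitP => // [j /= /val_inj->//|j /= E];
    have := ltn_ord i; rewrite E ltnNge leq_addr.
  by have := H (rshift p i); case: splitP => // [j /= E|j /= /addnI/val_inj->//];
    have := ltn_ord j; rewrite -E ltnNge leq_addr.
have [next nextP] := choice step.
pose seqI i : bad := iter i next (exist _ I (conj idI NdecI)).
have [i|i|i] := @mpoly_acc (fun i => sval (seqI i)).
- by case: (svalP (seqI i)).
- exact: properW (nextP (seqI i)).
- by have [_] := nextP (seqI i).
Qed.

End Noetherian.

(** * Length of prime chains in polynomial rings *)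

Section KrullDimension.
Variables (K : fieldType) (n : nat).
Local Notation R := {mpoly K[n]}.

Lemma card_bmultinom d : (#|{: 'X_{1..n < d}}| <= d ^ n)%N.
Proof.
have lt_d (m : 'X_{1..n < d}) i : (bmnm m i < d)%N.
  by apply: leq_ltn_trans (bmdeg m); rewrite mdegE (bigD1 i) //= leq_addr.
rewrite -[X in (_ <= X ^ _)%N]card_ord -[X in (_ <= _ ^ X)%N]card_ord -card_ffun.
apply: (leq_card (fun m : 'X_{1..n < d} => [ffun i => Ordinal (lt_d m i)])).
move=> m1 m2 /ffunP eqm; apply/val_inj/mnmP => i.
by have := eqm i; rewrite !ffunE => -[].
Qed.

(** The coefficient matrix has more rows than there are monomials of degree below [d], so its rows
    are dependent. *)
Lemma mpoly_linear_dependence (T : eqType) (w : seq T) (p : T -> R) d :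
  uniq w -> (forall a, a \in w -> (msize (p a) <= d)%N) -> (d ^ n < size w)%N ->
  exists c : T -> K, (exists2 a, a \in w & c a != 0) /\
    \sum_(a <- w) c a *: p a = 0.
Proof.
case: w => [//|x0 w'] uw; set w := x0 :: w' in uw * => pd lt_w.
pose A := \matrix_(i < size w, j < #|{: 'X_{1..n < d}}|)
  (p (nth x0 w i))@_(bmnm (enum_val j)).
have : kermx A != 0.
  rewrite kermx_eq0 /row_free neq_ltn; apply/orP; left.
  by apply: leq_ltn_trans (rank_leq_col _) (leq_ltn_trans (card_bmultinom d) lt_w).
case/rowV0Pn => u /sub_kermxP uA u0.
pose c a := oapp (u 0) 0 (insub (index a w)).
have cE (i : 'I_(size w)) : c (nth x0 w i) = u 0 i.
  by rewrite /c index_uniq // valK.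
exists c; split.
  have [i ui|u_eq0] := pickP (fun i => u 0 i != 0).
    by exists (nth x0 w i); rewrite ?mem_nth ?cE.
  case/eqP: u0; apply/rowP => i; rewrite mxE; apply/eqP.
  by have := u_eq0 i; case: eqP.
rewrite (big_nth x0) big_mkord; apply/mpolyP => m; rewrite mcoeff0 linear_sum /=.
under eq_bigr do rewrite mcoeffZ cE.
have [lt_md|le_dm] := ltnP (mdeg m) d; last first.
  rewrite big1 // => i _; rewrite memN_msupp_eq0 ?mulr0 //.
  by apply: msize_mdeg_ge; apply: leq_trans le_dm; apply/pd/mem_nth.
have := congr1 (fun B : 'rV_ _ => B 0 (enum_rank (BMultinom lt_md))) uA.
rewrite !mxE => {2}<-; apply: eq_bigr => i _.
by rewrite !mxE enum_rankK.
Qed.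

(** A word is an exponent vector of length [r] with entries below [s]; its head is the exponent of
    [y 0], so recursion on [r] treats the lexicographically dominant variable first. *)
Fixpoint words (s r : nat) : seq (seq nat) :=
  if r is r'.+1 then [seq e :: a | e <- iota 0 s, a <- words s r'] else [:: [::]].

Fixpoint word_monomial (y : nat -> R) (a : seq nat) : R :=
  if a is e :: b then y 0%N ^+ e * word_monomial (fun i => y i.+1) b else 1.

Lemma size_words s r : size (words s r) = (s ^ r)%N.
Proof. by elim: r => //= r IHr; rewrite size_allpairs size_iota IHr expnS. Qed.

Lemma uniq_words s r : uniq (words s r).
Proof.
elim: r => //= r IHr; apply: allpairs_uniq => //; first exact: iota_uniq.
by move=> [e a] [f b] _ _ [-> ->].
Qed.

Lemma msizeM_leD (p q : R) : (msize (p * q) <= msize p + msize q)%N.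
Proof.
have [->|p0] := eqVneq p 0; first by rewrite mul0r msize0.
have [->|q0] := eqVneq q 0; first by rewrite mulr0 msize0.
by rewrite msizeM // leq_pred.
Qed.

Lemma msize_exp_le (p : R) d e : (msize p <= d)%N -> (msize (p ^+ e) <= e * d + 1)%N.
Proof.
move=> pd; elim: e => [|e IHe]; first by rewrite expr0 msize1.
rewrite exprS mulSn -addnA; apply: leq_trans (msizeM_leD _ _) _.
exact: leq_add.
Qed.

Lemma msize_word_monomial (y : nat -> R) d s r a :
  (forall i, (i < r)%N -> (msize (y i) <= d)%N) -> a \in words s r ->
  (msize (word_monomial y a) <= r * (s * d + 1) + 1)%N.
Proof.
elim: r y a => [|r IHr] y a yd /=; first by rewrite inE => /eqP->; rewrite msize1.
case/allpairsP => -[e b] /= [es bw ->] /=.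
apply: leq_trans (msizeM_leD _ _) _.
  rewrite mulSn -addnA; apply: leq_add.
  apply: leq_trans (msize_exp_le e (yd 0%N isT)) _.
  by rewrite leq_add2r leq_mul2r; move: es; rewrite mem_iota /= => /ltnW->; rewrite orbT.
by apply: IHr => // i; exact: (yd i.+1).
Qed.

(* Coquand and Lombardi: an algebraic relation between the [y i], read in
   increasing lexicographic order of its exponents, would put 1 in the last
   prime of the chain. *)
Lemma prime_chain_algebraic_independence s r (C : nat -> set R) (y : nat -> R)
    (c : seq nat -> K) :
  (forall i, (i <= r)%N -> is_prime_ideal (C i)) ->
  (forall i, (i < r)%N -> (C i `<=` C i.+1)%classic) ->
  (forall i, (i < r)%N -> C i.+1 (y i) /\ ~ C i (y i)) ->
  C 0%N (\sum_(a <- words s r) c a *: word_monomial y a) ->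
  forall a, a \in words s r -> c a = 0.
Proof.
elim: r C y c => [|r IHr] C y c prC CS yC.
  rewrite big_seq1 => C0 a; rewrite inE => /eqP->; apply: contrapT => /eqP c0.
  have /is_prime_idealP[idC C1 _] := prC 0%N isT; apply: C1.
  have -> : 1 = (c [::])^-1%:MP * (c [::] *: 1) :> R.
    by rewrite mul_mpolyC scalerA mulVf // scale1r.
  exact: is_idealMl.
pose G e := \sum_(a <- words s r) c (e :: a) *: word_monomial (fun i => y i.+1) a.
have -> : \sum_(a <- words s r.+1) c a *: word_monomial y a
          = \sum_(0 <= e < s) y 0%N ^+ e * G e.
  rewrite /= big_allpairs_dep /index_iota subn0; apply: eq_bigr => e _.
  by rewrite mulr_sumr; apply: eq_bigr => a _ /=; rewrite scalerAr.
move=> C0; suff ce e a : (e < s)%N -> a \in words s r -> c (e :: a) = 0.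
  by move=> _ /allpairsP[[e a] /= [+ aw ->]]; rewrite mem_iota => /ce; apply.
elim/ltn_ind: e a => e IHe a es.
apply: (IHr (fun i => C i.+1) (fun i => y i.+1) (fun b => c (e :: b))).
- by move=> i; exact: (prC i.+1).
- by move=> i; exact: (CS i.+1).
- by move=> i; exact: (yC i.+1).
have [C1y C0y] := yC 0%N isT.
have /is_prime_idealP[idC1 _ _] := prC 1%N isT.
have prC0 := prC 0%N isT; have /is_prime_idealP[_ _ prodC0] := prC0.
(* The terms below [e] vanish by induction, so the sum is [y 0 ^+ e * (y 0 * H + G e)]. The prime
   [C 0] misses [y 0], so the second factor is in [C 0], hence in [C 1]; as [y 0] is in [C 1], so is
   [G e]. *)
pose H := \sum_(e.+1 <= i < s) y 0%N ^+ (i - e.+1) * G i.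
rewrite -[\sum_(a <- _) _]/(G e); apply: (@is_idealDr _ _ idC1 (y 0%N * H)).
  exact: is_idealMr.
apply: (CS 0%N isT).
have split_e : \sum_(0 <= i < s) y 0%N ^+ i * G i
    = y 0%N ^+ e * (y 0%N * H + G e).
  rewrite (@big_cat_nat _ _ _ e 0 s) /= ?(ltnW es) // big_nat big1 ?add0r; last first.
    move=> i ie; rewrite /G big1_seq ?mulr0 // => b /andP[_ bw].
    by rewrite IHe ?scale0r // (ltn_trans ie).
  rewrite big_ltn // mulrDr addrC; congr (_ + _).
  rewrite /H !mulr_sumr; apply: eq_big_nat => i /andP[ei _].
  by rewrite !mulrA -exprSr -exprD subnKC.
by move: C0; rewrite split_e => /prodC0[/(prime_exp prC0)|].
Qed.

(** A longer chain gives [n.+1] algebraically independent [y i]. Their [s ^ n.+1] monomials with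
    exponents below [s] have degree linear in [s], so they lie in a space of dimension of order
    [s ^ n] and are dependent for large [s]. *)
Lemma prime_chain_length m (C : nat -> set R) (y : nat -> R) :
  (forall i, (i <= m)%N -> is_prime_ideal (C i)) ->
  (forall i, (i < m)%N -> (C i `<=` C i.+1)%classic) ->
  (forall i, (i < m)%N -> C i.+1 (y i) /\ ~ C i (y i)) -> (m <= n)%N.
Proof.
move=> prC CS yC; rewrite leqNgt; apply/negP => nm.
(* [b * s] bounds the size of every word monomial, and [s > b ^ n] gives
   [(b * s) ^ n < s ^ n.+1]. *)
pose d := \max_(i < n.+1) msize (y i); pose b := (n.+1 * (d + 1) + 1)%N.
pose s := (b ^ n).+1.
have yd i : (i < n.+1)%N -> (msize (y i) <= d)%N.
  by move=> lt_i; exact: (leq_bigmax (Ordinal lt_i)).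
have [||c [[a aw ca0] dep]] := @mpoly_linear_dependence _ (words s n.+1)
    (word_monomial y) (b * s) (uniq_words _ _).
- move=> a /(msize_word_monomial yd)/leq_trans; apply.
  rewrite /b mulnDl mul1n leq_add // -mulnA leq_mul2l /= mulnDl mul1n.
  by rewrite mulnC leq_add2l.
- by rewrite size_words expnMn expnS ltn_mul2r expn_gt0 /=.
case/eqP: ca0; apply: (@prime_chain_algebraic_independence s n.+1 C y) => //.
- by move=> i lei; apply/prC/(leq_trans lei).
- by move=> i lti; apply/CS/(leq_trans lti).
- by move=> i lti; apply/yC/(leq_trans lti).
- by rewrite dep; apply: is_ideal0; have /is_prime_idealP[] := prC 0%N isT.
Qed.

End KrullDimension.

(** * Vanishing ideals of linear subspaces *)

(** In characteristic zero the first [size p] natural numbers stay distinct in [K], one more than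
    the degree. *)
Lemma poly_nonroot (K : fieldType) (p : {poly K}) :
  [pchar K] =i pred0 -> p != 0 -> exists t, p.[t] != 0.
Proof.
move=> /pcharf0P char0 p0; apply: contrapT => /forallNP rootp.
have natr_inj : injective (fun i : nat => i%:R : K).
  move=> i j /eqP; wlog le_ij : i j / (i <= j)%N => [th|].
    by case/orP: (leq_total i j) => /th // th'; rewrite eq_sym => /th'.
  rewrite eq_sym -subr_eq0 -natrB // char0 subn_eq0 => le_ji.
  by apply/eqP; rewrite eqn_leq le_ij.
have := @max_poly_roots _ p [seq i%:R | i <- iota 0 (size p)] p0.
rewrite size_map size_iota ltnn (map_inj_uniq natr_inj) iota_uniq => H.
suff : false by []; apply: H => //; apply/allP => t _.
by apply/rootP; have /negP/negPn/eqP := rootp t.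
Qed.

Section VanishingIdeal.
Variables (K : fieldType) (l : nat).
Local Notation R := {mpoly K[l.+1]}.
Local Notation V := 'rV[K]_l.+1.
Implicit Types (E : set V) (U W : {vspace V}) (w : V) (p q : R) (a : dual K l).

Lemma meval_linform a w : (linform a).@[w 0] = a w.
Proof.
rewrite [w in RHS]row_sum_delta linear_sum /= /linform raddf_sum /=.
by apply: eq_bigr => j _; rewrite mevalZ mevalXU linearZ /= mulrC.
Qed.

Definition vanishing_ideal E : set R := fun p => forall w, E w -> p.@[w 0] = 0.

Lemma vanishing_ideal_is_ideal E : is_ideal (vanishing_ideal E).
Proof.
split=> [w _|b p q Ep Eq w Ew]; first by rewrite meval0.
by rewrite mevalD mevalM Ep // Eq // mulr0 addr0.
Qed.

Lemma meval_line p w1 w2 : exists r : {poly K},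
  forall t, r.[t] = p.@[(w1 + t *: (w2 - w1)) 0].
Proof.
exists (mmap polyC (fun i => (w1 0 i)%:P + 'X * (w2 0 i - w1 0 i)%:P) p) => t.
rewrite mevalE /mmap horner_sum; apply: eq_bigr => m _.
rewrite hornerM hornerC /mmap1 horner_prod; congr (_ * _).
by apply: eq_bigr => i _; rewrite horner_exp !hornerE !mxE.
Qed.

Hypothesis char0 : [pchar K] =i pred0.

(** Join points of [E] where [p] and [q] do not vanish by a line inside [E]: both restrict to
    nonzero univariate polynomials, whose product has a nonroot. *)
Lemma vanishing_ideal_prime E : E 0 ->
  (forall w1 w2 t, E w1 -> E w2 -> E (w1 + t *: (w2 - w1))) ->
  is_prime_ideal (vanishing_ideal E).
Proof.
move=> E0 affE; apply/is_prime_idealP; split.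
- exact: vanishing_ideal_is_ideal.
- by move=> /(_ 0 E0); rewrite meval1; apply/eqP; rewrite oner_eq0.
move=> p q Epq; apply: contrapT => /not_orP[/existsNP[w1 Np] /existsNP[w2 Nq]].
have {Np} [Ew1 /eqP p1] : E w1 /\ p.@[w1 0] <> 0 by move/not_implyP: Np.
have {Nq} [Ew2 /eqP q2] : E w2 /\ q.@[w2 0] <> 0 by move/not_implyP: Nq.
have [r rE] := meval_line p w1 w2; have [s sE] := meval_line q w1 w2.
have r0 : r != 0.
  by apply: contraNneq p1 => r0; rewrite -[w1]addr0 -(scale0r (w2 - w1)) -rE r0 horner0.
have s0 : s != 0.
  by apply: contraNneq q2 => s0; rewrite -[w2](subrKC w1) -[w2 - _]scale1r -sE s0 horner0.
have [t] := poly_nonroot char0 (mulf_neq0 r0 s0); case/eqP.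
by rewrite hornerM rE sE -mevalM; apply/Epq/affE.
Qed.

Definition flag U (y : nat -> dual K l) (s : nat) : set V :=
  fun w => w \in U /\ forall i, (i < s)%N -> y i w = 0.

Section Flag.
Variables (U : {vspace V}) (y : nat -> dual K l) (v : nat -> V) (r : nat).
Hypothesis Uv : forall i, (i < r)%N -> v i \in U.
Hypothesis yv : forall i j, (i < r)%N -> (j < r)%N -> y i (v j) = (i == j)%:R.

Lemma flag_prime s : is_prime_ideal (vanishing_ideal (flag U y s)).
Proof.
apply: vanishing_ideal_prime; first by split=> [|i _]; rewrite ?mem0v ?linear0.
move=> w1 w2 t [U1 y1] [U2 y2]; split; first by rewrite rpredD ?rpredZ ?rpredB.
by move=> i lt_i; rewrite linearD linearZ linearB /= y1 ?y2 // subrr scaler0 addr0.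
Qed.

Lemma flag_subS s :
  (vanishing_ideal (flag U y s) `<=` vanishing_ideal (flag U y s.+1))%classic.
Proof. by move=> p Fp w [Uw yw]; apply: Fp; split=> // i /ltnW/yw. Qed.

Lemma flag_linform s : vanishing_ideal (flag U y s.+1) (linform (y s)).
Proof. by move=> w [_ yw]; rewrite meval_linform yw. Qed.

Lemma flag_not_linform s : (s < r)%N -> ~ vanishing_ideal (flag U y s) (linform (y s)).
Proof.
move=> lt_s /(_ (v s)); rewrite meval_linform yv // eqxx => H.
suff : (1 : K) == 0 by rewrite oner_eq0.
apply/eqP/H; split; first exact: Uv.
by move=> i lt_i; rewrite yv // ?(ltn_trans lt_i) // ltn_eqF.
Qed.

End Flag.

Lemma vspace_dual_family U : exists (y : nat -> dual K l) (v : nat -> V),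
  (forall i, (i < \dim U)%N -> v i \in U) /\
  forall i j, (i < \dim U)%N -> (j < \dim U)%N -> y i (v j) = (i == j)%:R.
Proof.
pose dualv (i : 'I_(\dim U)) : dual K l :=
  linfun (coord (vbasis U) i : {linear V -> K^o}).
exists (fun i => oapp dualv 0 (insub i)).
exists (fun i => (vbasis U)`_i); split=> [i lt_i|i j lt_i lt_j].
  by apply: vbasis_mem; apply: mem_nth; rewrite size_tuple.
rewrite insubT /= lfunE /= -[j]/(val (Ordinal lt_j)).
by rewrite coord_free ?(basis_free (vbasisP U)) // -val_eqE /= eq_sym.
Qed.

(* A chain of primes ending inside the ideal of [U] is prolonged by the ideals
   of a complete flag of [U]; the total length is at most the number of
   variables. *)
Lemma vanishing_ideal_height U m (C : 'I_m.+1 -> set R) :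
  (forall i, is_prime_ideal (C i)) ->
  (forall i j : 'I_m.+1, (i < j)%N -> (C i `<` C j)%classic) ->
  (C ord_max `<=` vanishing_ideal (fun w => w \in U))%classic ->
  (m + \dim U <= l.+1)%N.
Proof.
move=> prC CS CU; have [y [v [Uv yv]]] := vspace_dual_family U.
have lt_inord (i : nat) : (i < m)%N -> ((inord i : 'I_m.+1) < (inord i.+1 : 'I_m.+1))%N.
  by move=> lt_i; rewrite !inordK // ltnW.
have /choice[z zP] i : exists z, (i < m)%N -> C (inord i.+1) z /\ ~ C (inord i) z.
  have [lt_i|_] := ltnP i m; last by exists 0.
  have [_ /existsNP[z /not_implyP zP]] := CS _ _ (lt_inord i lt_i).
  by exists z.
pose B i := if (i <= m)%N then C (inord i) else vanishing_ideal (flag U y (i - m)).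
pose x i := if (i < m)%N then z i else linform (y (i - m)%N).
(* At the junction [i = m] the chain still holds [C ord_max], which is only included in the first
   ideal of the flag. *)
have BU i : (m <= i)%N -> (B i `<=` vanishing_ideal (flag U y (i - m)))%classic.
  rewrite leq_eqVlt => /predU1P[<-|lt_mi]; last by rewrite /B leqNgt lt_mi.
  rewrite /B leqnn subnn (_ : inord m = ord_max); last by apply/val_inj; rewrite /= inordK.
  by apply: subset_trans CU _ => p pU w [Uw _]; apply: pU.
apply: (@prime_chain_length K l.+1 _ B x).
- by move=> i _; rewrite /B; case: ifP => _ //; apply: flag_prime.
- move=> i _; have [lt_im|le_mi] := ltnP i m.
    by rewrite /B lt_im (ltnW lt_im); have [] := CS _ _ (lt_inord i lt_im).
  apply: subset_trans (BU _ le_mi) _; rewrite /B leqNgt ltnS le_mi /= subSn //.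
  exact: flag_subS.
move=> i; rewrite /x; have [lt_im _|le_mi lt_i] := ltnP i m.
  by rewrite /B lt_im (ltnW lt_im); apply: zP.
split; first by rewrite /B leqNgt ltnS le_mi /= subSn //; apply: flag_linform.
by move/(BU _ le_mi); apply: (flag_not_linform Uv yv); rewrite ltn_subLR.
Qed.

(** Otherwise the zero ideal lies strictly below the prime ideal of the full space, and prolonging
    this by a flag gives [l.+2] steps in [l.+1] variables. *)
Lemma vanishing_ideal_fullv p : (forall w, p.@[w 0] = 0) -> p = 0.
Proof.
move=> p_van; apply/eqP/negPn/negP => /eqP p0.
pose vanV := vanishing_ideal (fun w => w \in {:V}%VS).
pose C (i : 'I_2) : set R := if i == 0 then (fun q => q = 0) else vanV.
suff : (1 + \dim {:V}%VS <= l.+1)%N by rewrite dimvf /dim /= mul1n ltnn.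
apply: (@vanishing_ideal_height _ 1 C) => //.
- move=> i; rewrite /C; case: ifP => _.
    apply/is_prime_idealP; split; last first.
    + by move=> u v /eqP; rewrite mulf_eq0 => /orP[]/eqP; [left|right].
    + by apply/eqP; rewrite oner_eq0.
    by split=> // a u v -> ->; rewrite mulr0 addr0.
  by apply: vanishing_ideal_prime => *; rewrite memvf.
- move=> [[|[|//]] ?] [[|[|//]] ?] //= _; rewrite /C /=; split.
    by move=> q ->; apply: is_ideal0; apply: vanishing_ideal_is_ideal.
  by move=> /(_ p (fun w _ => p_van w)).
Qed.

Lemma ideal_comp_mpoly (P : set R) (h : l.+1.-tuple R) p : is_ideal P ->
  (forall j, P ('X_j - tnth h j)) -> P (p - (p \mPo h)).
Proof.
move=> idP Ph.
have mulP u u' v v' : P (u - u') -> P (v - v') -> P (u * v - u' * v').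
  move=> Pu Pv; have -> : u * v - u' * v' = u * (v - v') + (u - u') * v'.
    by rewrite mulrBr mulrBl addrA subrK.
  by apply: is_idealD => //; [apply: is_idealMl | apply: is_idealMr].
elim/mpolyind: p => [|c m p _ _ IHp]; first by rewrite comp_mpoly0 subrr; apply: is_ideal0.
rewrite comp_mpolyD comp_mpolyZ opprD addrACA; apply: is_idealD => //.
rewrite -scalerBr -mul_mpolyC; apply: is_idealMl => //.
rewrite comp_mpolyX mpolyXE_id; apply: (big_rec2 (fun u v => P (u - v))).
  by rewrite subrr; apply: is_ideal0.
move=> i u v _ Puv; apply: (mulP _ _ _ _) => //; elim: (m i) => [|e IHe].
  by rewrite !expr0 subrr; apply: is_ideal0.
by rewrite !exprS; apply: mulP.
Qed.

(** [P] contains the ideal of the common zeros of the [y i], so the ideals of the shorter flags,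
    topped by [P], form a chain of length [r]. *)
Lemma dual_family_height (P : set R) (y : nat -> dual K l) (v : nat -> V) r k :
  is_prime_ideal P -> height_le P k ->
  (forall i j, (i < r)%N -> (j < r)%N -> y i (v j) = (i == j)%:R) ->
  (forall i, (i < r)%N -> P (linform (y i))) -> (r <= k)%N.
Proof.
move=> prP htP yv yP; have /is_prime_idealP[idP _ _] := prP.
have flagP : (vanishing_ideal (flag fullv y r) `<=` P)%classic.
  move=> p pF.
  (* [h] is the projection along the [v i] onto the common zeros of the [y i]. Composition with it
     kills [p], and it differs from the identity by elements of [P]. *)
  pose h := [tuple 'X_j - \sum_(i < r) (v i 0 j) *: linform (y i) | j < l.+1].
  have hE w j : (tnth h j).@[w 0] = (w - \sum_(i < r) y i w *: v i) 0 j.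
    rewrite tnth_mktuple mevalB mevalXU (big_morph _ (mevalD _) (meval0 _)) !mxE summxE.
    congr (_ - _).
    by apply: eq_bigr => i _; rewrite mevalZ meval_linform mxE mulrC.
  have ph0 : p \mPo h = 0.
    apply: vanishing_ideal_fullv => w; rewrite comp_mpoly_meval.
    rewrite (@meval_eq _ _ _ ((w - \sum_(i < r) y i w *: v i) 0)) //.
    apply: pF; split; first exact: memvf.
    move=> i lt_i; rewrite linearB linear_sum /= (bigD1 (Ordinal lt_i)) //=.
    rewrite linearZ /= yv // eqxx [_ *: 1]mulr1 big1 ?addr0 ?subrr // => j.
    by rewrite -val_eqE /= eq_sym => ji; rewrite linearZ /= yv // (negPf ji) scaler0.
  rewrite -[p]subr0 -ph0; apply: ideal_comp_mpoly => // j.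
  rewrite tnth_mktuple subKr; apply: is_ideal_sum => // i _.
  by rewrite -mul_mpolyC; apply: is_idealMl => //; apply: yP.
pose C (i : 'I_r.+1) := if (i < r)%N then vanishing_ideal (flag fullv y i) else P.
have Uv i : (i < r)%N -> v i \in fullv by rewrite memvf.
have flag_le i j : (i <= j)%N ->
    (vanishing_ideal (flag fullv y i) `<=` vanishing_ideal (flag fullv y j))%classic.
  move=> le_ij p pF w [Uw yw]; apply: pF; split=> // s lt_s.
  exact: yw (leq_trans lt_s le_ij).
apply: (htP r C).
- by move=> i; rewrite /C; case: ifP => // _; apply: flag_prime.
- move=> i j lt_ij; have lt_ir : (i < r)%N by rewrite (leq_trans lt_ij) -1?ltnS.
  rewrite /C lt_ir; case: ifP => [lt_jr|_]; split.
  + exact/flag_le/ltnW.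
  + move/(_ (linform (y i)) (flag_le _ _ lt_ij _ (@flag_linform fullv y i))).
    exact: (flag_not_linform Uv yv).
  + exact: subset_trans (flag_le _ _ (ltnW lt_ir)) flagP.
  + by move/(_ _ (yP i lt_ir)); apply: (flag_not_linform Uv yv).
- by rewrite /C /= ltnn.
Qed.

End VanishingIdeal.

(** * Independent linear forms and perspectivity *)

Section DualFamilies.
Variables (K : fieldType) (l n : nat).
Local Notation V := 'rV[K]_l.+1.
Implicit Types (alpha : 'I_n -> dual K l) (a b : dual K l) (B X Y : {set 'I_n}).

Lemma sum_lfun_app (T : Type) (r : seq T) (Q : pred T) (c : T -> K)
    (a : T -> dual K l) (x : V) :
  (\sum_(i <- r | Q i) c i *: a i) x = \sum_(i <- r | Q i) c i * a i x.
Proof. by rewrite sum_lfunE; apply: eq_bigr => i _; rewrite scale_lfunE. Qed.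

Lemma dual_app a (x : V) : a x = \sum_j a (delta_mx 0 j) * x 0 j.
Proof.
rewrite [x in LHS]row_sum_delta linear_sum /=.
by apply: eq_bigr => j _; rewrite linearZ /= mulrC.
Qed.

Lemma lker_sub_eq a b : (lker a <= lker b)%VS -> b != 0 -> lker a = lker b.
Proof.
move=> /subvP ab b0; have [[u au]|a_eq0] := pselect (exists u, a u != 0); last first.
  apply/eqP; rewrite eqEsubv; apply/andP; split; apply/subvP => // x _.
  by rewrite memv_ker; apply: contrapT => /negP ax; apply: a_eq0; exists x.
have ba x : b x = a x * (b u / a u).
  have : x - (a x / a u) *: u \in lker b.
    by apply: ab; rewrite memv_ker linearB linearZ /= [_ *: _]divfK ?subrr.
  by rewrite memv_ker linearB linearZ /= subr_eq0 => /eqP->; rewrite [_ *: _]mulrAC mulrA.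
have bu : b u != 0.
  apply: contra_neq b0 => bu; apply/lfunP => x.
  by rewrite ba bu mul0r mulr0 lfunE.
apply/vspaceP => x; rewrite !memv_ker ba mulf_eq0 [X in _ || X](_ : _ = false) ?orbF //.
by apply/negbTE; rewrite mulf_neq0 ?invr_eq0.
Qed.

Lemma linear_matroid_enumP alpha X : X \in linear_matroid alpha <->
  forall k : 'I_#|X| -> K, \sum_s k s *: alpha (enum_val s) = 0 -> forall s, k s = 0.
Proof.
rewrite inE -[X in free X]/(val (map_tuple alpha (enum_tuple X))).
have E (k : 'I_#|X| -> K) : \sum_s k s *: (map_tuple alpha (enum_tuple X))`_s
    = \sum_s k s *: alpha (enum_val s).
  apply: eq_bigr => s _; rewrite (nth_map (enum_val s)) -?enum_val_nth //.
  by rewrite size_tuple.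
by split=> [/freeP H k|H]; [rewrite -E; apply: H | apply/freeP => k; rewrite E; apply: H].
Qed.

Lemma linear_matroidP alpha X : X \in linear_matroid alpha <->
  forall c : 'I_n -> K, \sum_(i in X) c i *: alpha i = 0 -> forall i, i \in X -> c i = 0.
Proof.
split=> [/linear_matroid_enumP H c|H].
  rewrite big_enum_val => /H c0 i iX.
  by rewrite -(enum_rankK_in iX iX) c0.
apply/linear_matroid_enumP => k k0 s.
pose c i := \sum_(s | enum_val s == i) k s.
have cE t : c (enum_val t) = k t.
  by rewrite /c (big_pred1 t) // => t'; rewrite (inj_eq enum_val_inj).
rewrite -cE; apply: H; last exact: enum_valP.
by rewrite big_enum_val -[RHS]k0; apply: eq_bigr => t _; rewrite cE.
Qed.

Lemma not_linear_matroid alpha X : X \notin linear_matroid alpha ->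
  exists d : 'I_n -> K, \sum_(i in X) d i *: alpha i = 0 /\
    exists2 i, i \in X & d i != 0.
Proof.
move/negP; apply: contra_notP => /forallNP noD; apply/linear_matroidP => c c0 i iX.
by apply: contrapT => /eqP ci; apply: (noD c); split=> //; exists i.
Qed.

Lemma linear_matroid0 alpha : finset.set0 \in linear_matroid alpha.
Proof. by apply/linear_matroidP => c _ i; rewrite inE. Qed.

Lemma dependent_extension alpha B j : B \in linear_matroid alpha -> j \notin B ->
  j |: B \notin linear_matroid alpha ->
  exists c : 'I_n -> K, alpha j = \sum_(i in B) c i *: alpha i.
Proof.
move=> /linear_matroidP indB jB /not_linear_matroid[d []].
rewrite big_setU1 //= => d_dep [i ijB di].
have dj : d j != 0.
  apply: contra_neq di => dj; move: d_dep; rewrite dj scale0r add0r => /indB d0.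
  by move: ijB; rewrite !inE => /predU1P[->|/d0].
exists (fun i => - (d i / d j)); apply: (scalerI dj).
move/eqP: d_dep; rewrite addr_eq0 => /eqP->; rewrite scaler_sumr -sumrN.
by apply: eq_bigr => s _; rewrite scalerA mulrN mulrC divfK // scaleNr.
Qed.

Lemma exists_basis alpha Y : exists B : {set 'I_n},
  [/\ B \subset Y, B \in linear_matroid alpha &
      forall j, j \in Y -> exists c : 'I_n -> K, alpha j = \sum_(i in B) c i *: alpha i].
Proof.
have P0 : (finset.set0 \in linear_matroid alpha) && (finset.set0 \subset Y).
  by rewrite linear_matroid0 finset.sub0set.
case: (@arg_maxnP _ finset.set0 (fun B => (B \in linear_matroid alpha) && (B \subset Y))
  (fun B => #|B|) P0) => B /andP[indB BY] maxB.
exists B; split=> // j jY; have [jB|jB] := boolP (j \in B).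
  exists (fun i => (i == j)%:R); rewrite (bigD1 j) //= eqxx scale1r big1 ?addr0 //.
  by move=> i /andP[_ /negPf->]; rewrite scale0r.
apply: dependent_extension => //; apply/negP => indjB.
have := maxB (j |: B); rewrite indjB finset.subUset finset.sub1set jY BY => /(_ isT).
by rewrite /= cardsU1 jB add1n ltnn.
Qed.

(** The coefficient matrix of independent forms has full row rank; the columns of a right inverse
    serve as dual vectors. *)
Lemma exists_dual_vectors alpha B : B \in linear_matroid alpha ->
  exists v : 'I_n -> V, forall i j, i \in B -> j \in B -> alpha i (v j) = (i == j)%:R.
Proof.
move=> /linear_matroid_enumP indB.
pose A := \matrix_(s < #|B|, t < l.+1) alpha (enum_val s) (delta_mx 0 t).
have /row_freeP[N AN] : row_free A.
  apply: inj_row_free => u uA; apply/rowP => s; rewrite mxE.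
  apply: (indB (u 0)); apply/lfunP => x; rewrite sum_lfun_app lfunE /=.
  transitivity ((u *m A *m x^T) 0 0); last by rewrite uA mul0mx mxE.
  rewrite -mulmxA mxE; apply: eq_bigr => t _; rewrite dual_app mxE; congr (_ * _).
  by apply: eq_bigr => j _; rewrite !mxE.
exists (fun j => \sum_(s | enum_val s == j) (col s N)^T) => i j iB jB.
rewrite -(enum_rankK_in iB iB) -(enum_rankK_in iB jB).
set s := enum_rank_in iB i; set t := enum_rank_in iB j.
rewrite (big_pred1 t) => [|t']; last by rewrite (inj_eq enum_val_inj).
rewrite (inj_eq enum_val_inj) -[RHS](mxE tt (fun s t : 'I_#|B| => (s == t)%:R)) dual_app.
have /(congr1 (fun M : 'M_#|B| => M s t)) := AN; rewrite !mxE => <-.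
by apply: eq_bigr => j' _; rewrite !mxE.
Qed.

Lemma mem_flat_space alpha B w :
  (w \in flat_space alpha B) <-> forall i, i \in B -> alpha i w = 0.
Proof.
rewrite memvE; split=> [/subv_bigcapP H i iB|H].
  by have := H i iB; rewrite -memvE memv_ker => /eqP.
by apply/subv_bigcapP => i iB; rewrite -memvE memv_ker H.
Qed.

Lemma dim_flat_space alpha B : (l.+1 <= \dim (flat_space alpha B) + #|B|)%N.
Proof.
rewrite /flat_space -big_enum cardE /=; elim: (enum B) => [|i s IHs].
  by rewrite big_nil dimvf /dim /= mul1n addn0.
rewrite big_cons /= addnS -addSn; apply: leq_trans IHs _; rewrite leq_add2r.
set W := (\bigcap_(j <- s) _)%VS; rewrite -(limg_ker_dim (alpha i) W) capvC.
rewrite -[X in (_ <= X)%N]addn1 leq_add2l.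
by apply: leq_trans (dimvS (subvf _)) _; rewrite dimvf.
Qed.

Lemma span_vanish alpha B (c : 'I_n -> K) j w : alpha j = \sum_(i in B) c i *: alpha i ->
  w \in flat_space alpha B -> alpha j w = 0.
Proof.
move=> -> /mem_flat_space Bw; rewrite sum_lfun_app big1 // => i /Bw->.
by rewrite mulr0.
Qed.

(** General position speaks of flats, so [B] has to be enlarged to all hyperplanes through its flat
    space. A form spanned by forms of this set vanishes on that space and so belongs to the set. *)
Lemma flat_closure alpha B :
  matroid_flat (linear_matroid alpha) [set j | (flat_space alpha B <= lker (alpha j))%VS].
Proof.
set F := [set j | _]; move=> j jF; rewrite {1}/matroid_rank.
have [|Z] := @eq_bigmax_cond _
    (fun Z : {set 'I_n} => (Z \in linear_matroid alpha) && (Z \subset F)) (fun Z => #|Z|).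
  by apply/card_gt0P; exists finset.set0; rewrite unfold_in /= linear_matroid0 finset.sub0set.
rewrite unfold_in /= => /andP[indZ ZF] ->.
have jZ : j \notin Z by apply: contra jF; apply: (fintype.subsetP ZF).
have indjZ : j |: Z \in linear_matroid alpha.
  apply: contraNT jF => /(dependent_extension indZ jZ)[c cE].
  rewrite inE; apply/subvP => w wB; rewrite memv_ker; apply/eqP.
  apply: span_vanish cE _; apply/mem_flat_space => i /(fintype.subsetP ZF).
  by rewrite inE => /subvP/(_ w wB); rewrite memv_ker => /eqP.
have -> : #|Z|.+1 = #|j |: Z| by rewrite cardsU1 jZ.
apply: (@leq_bigmax_cond _ (fun Z : {set 'I_n} =>
  (Z \in linear_matroid alpha) && (Z \subset j |: F)) (fun Z => #|Z|)).
by rewrite indjZ finset.setUS.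
Qed.

(** The flat space has codimension at most [#|B|]: the bound [l] makes the flat nonempty, the bound
    [k] keeps its rank in range. The point [w] keeps [alpha0] out of the span of the forms in
    [B]. *)
Lemma general_position_point alpha a k B : general_linear_position k a alpha ->
  (#|B| <= k)%N -> (#|B| <= l)%N ->
  exists2 w, w \in flat_space alpha B & a w != 0.
Proof.
move=> glp leBk leBl.
set F := [set j | (flat_space alpha B <= lker (alpha j))%VS].
have FB : flat_space alpha F = flat_space alpha B.
  apply/vspaceP => w; apply/idP/idP => /mem_flat_space H; apply/mem_flat_space => i.
    by move=> iB; apply: H; rewrite inE; apply: bigcapv_inf iB _.
  rewrite inE => /subvP/(_ w); rewrite memv_ker => H'; apply/eqP/H'.
  exact/mem_flat_space.
have dimB := dim_flat_space alpha B.
have := glp F (@flat_closure alpha B); rewrite FB => H.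
have /subvPn[w wB] : ~~ (flat_space alpha B <= lker a)%VS.
  apply: H; last by rewrite /codim leq_subLR (leq_trans dimB) ?leq_add2l.
  by rewrite -dimv_eq0 -lt0n -(ltn_add2r #|B|) add0n (leq_trans _ dimB).
by rewrite memv_ker; exists w.
Qed.

End DualFamilies.

(** * Weak perspective representations and local directional derivatives *)

Section Perspectivity.
Variables (K : fieldType) (l n k : nat).
Variables (alpha : 'I_n -> dual K l) (alpha0 : dual K l) (lambda : 'I_n -> K).
Hypothesis arr : is_arrangement alpha.
Hypothesis le_kl : (2 <= k <= l)%N.
Hypothesis glp : general_linear_position k.+1 alpha0 alpha.
Let beta i := alpha i + lambda i *: alpha0.

(* The condition to which both sides of the equivalence reduce: on every flat
   of rank at most k, the form [\sum_i lambda i *: Q / alpha i] is locally a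
   directional derivative. *)
Definition locally_directional : Prop := forall B Y : {set 'I_n},
  B \in linear_matroid alpha -> (#|B| <= k)%N ->
  (forall j, j \in Y -> exists c : 'I_n -> K, alpha j = \sum_(i in B) c i *: alpha i) ->
  exists v, forall j, j \in Y -> alpha j v = lambda j.

Lemma sum_beta (d : 'I_n -> K) (X : {set 'I_n}) :
  \sum_(i in X) d i *: beta i =
  \sum_(i in X) d i *: alpha i + (\sum_(i in X) d i * lambda i) *: alpha0.
Proof.
rewrite scaler_suml -big_split; apply: eq_bigr => i _ /=.
by rewrite scalerDr scalerA.
Qed.

Lemma perspective_beta : perspective alpha0 alpha beta.
Proof.
have le1l : (1 <= l)%N by case/andP: le_kl => lt1k; apply: leq_trans; exact: ltnW.
have pt j : exists2 w, alpha j w = 0 & alpha0 w != 0.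
  have [||w] := general_position_point (B := [set j]) glp; rewrite ?cards1 //.
  by move=> /mem_flat_space/(_ j (set11 j)) aw a0w; exists w.
have pt' j : exists2 u, alpha0 u = 0 & alpha j u != 0.
  have [w aw a0w] := pt j.
  have [u au] : exists u, alpha j u != 0.
    apply: contrapT => /forallNP H; have /eqP[] := arr.1 j.
    by apply/lfunP => u; rewrite lfunE; apply/eqP; have /negP/negPn := H u.
  (* Moving along [w] brings [u] into the kernel of [alpha0] without changing [alpha j u]. *)
  exists (u - (alpha0 u / alpha0 w) *: w).
    by rewrite linearB linearZ /= [_ *: _]divfK // subrr.
  by rewrite linearB linearZ /= aw scaler0 subr0.
have betaE j x : beta j x = alpha j x + lambda j * alpha0 x.
  by rewrite /beta add_lfunE scale_lfunE.
split=> j.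
- have [w aw a0w] := pt j; apply: contraNneq a0w => E.
  by rewrite -memv_ker E memv_ker aw.
- have [u a0u au] := pt' j; apply: contraNneq au => E.
  have : u \in lker (beta j) by rewrite -E memv_ker a0u.
  by rewrite memv_ker betaE a0u mulr0 addr0.
- apply/vspaceP => x; rewrite !memv_cap !memv_ker betaE; apply: andb_id2r => /eqP->.
  by rewrite mulr0 addr0.
Qed.

(** Dual vectors give [u] with the right values on [B]. For another [j] in [Y], the set [j |: B] has
    at most [k.+1] elements, so its dependence passes to [beta]; splitting off [alpha0] leaves one
    relation shared by the [alpha i] and the [lambda i], which forces [alpha j u = lambda j]. *)
Lemma weak_representation_directional :
  weak_representation k.+1 alpha beta -> locally_directional.
Proof.
move=> weak B Y indB leBk spanY.
have [v vE] := exists_dual_vectors indB.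
pose u := \sum_(b in B) lambda b *: v b.
have uB i : i \in B -> alpha i u = lambda i.
  move=> iB; rewrite linear_sum /= (bigD1 i) //= linearZ /= vE // eqxx [_ *: 1]mulr1.
  rewrite big1 ?addr0 // => j /andP[jB ji].
  by rewrite linearZ /= vE // eq_sym (negPf ji) scaler0.
exists u => j jY; have [/uB//|jB] := boolP (j \in B).
have [c cE] := spanY j jY.
have card_jB : #|j |: B| = #|B|.+1 by rewrite cardsU1 jB.
have dep_alpha : j |: B \notin truncation (linear_matroid alpha) k.+1.
  rewrite inE card_jB ltnS leBk andbT; apply/negP => /linear_matroidP indjB.
  pose d i := if i == j then -1 else c i.
  suff /indjB/(_ j) : \sum_(i in j |: B) d i *: alpha i = 0.
    rewrite /d eqxx setU11 => /(_ isT)/eqP.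
    by rewrite oppr_eq0 oner_eq0.
  rewrite big_setU1 //= {1}/d eqxx scaleN1r {1}cE addrC; apply/eqP; rewrite subr_eq0.
  apply/eqP/eq_bigr => i iB; rewrite /d; case: eqP => // ij.
  by move: jB; rewrite -ij iB.
have := weak _ dep_alpha; rewrite inE card_jB ltnS leBk andbT.
move=> /not_linear_matroid[d []]; rewrite sum_beta => d_dep [i ijB di].
have [w wB a0w] : exists2 w, w \in flat_space alpha B & alpha0 w != 0.
  apply: general_position_point glp (leqW leBk) _.
  by rewrite (leq_trans leBk) //; case/andP: le_kl.
(* All [alpha s] with [s] in [j |: B] vanish at [w], so only the [alpha0] term of the relation
   survives there. *)
have dlambda : \sum_(i in j |: B) d i * lambda i = 0.
  have /lfunP/(_ w) := d_dep; rewrite add_lfunE sum_lfun_app scale_lfunE lfunE /=.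
  rewrite big1 ?add0r; last first.
    move=> s; rewrite !inE => /predU1P[->|sB].
      by rewrite (span_vanish cE wB) mulr0.
    by move/mem_flat_space: wB => /(_ s sB)->; rewrite mulr0.
  by move/eqP; rewrite [_ *: _ == 0]mulf_eq0 (negPf a0w) orbF => /eqP.
move: d_dep; rewrite dlambda scale0r addr0 => d_dep.
have dj : d j != 0.
  apply: contra_neq di => dj; move: d_dep; rewrite big_setU1 //= dj scale0r add0r.
  move/linear_matroidP: indB => indB /indB d0.
  by move: ijB; rewrite !inE => /predU1P[->|/d0].
have /lfunP/(_ u) := d_dep; rewrite sum_lfun_app lfunE /= -[RHS]dlambda.
rewrite !big_setU1 //= (eq_bigr (fun i => d i * lambda i)) => [|s /uB-> //].
by move/addIr/(mulfI dj).
Qed.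

(** A dependent set of size at most [k.+1] has a basis of size at most [k], so on it
    [lambda i = alpha i v]. Evaluating a relation of the [alpha i] at [v] kills the [alpha0] part,
    and the same coefficients relate the [beta i]. *)
Lemma directional_weak_representation :
  locally_directional -> weak_representation k.+1 alpha beta.
Proof.
move=> dir X.
have truncE M : (X \in truncation M k.+1) = (X \in M) && (#|X| <= k.+1)%N by rewrite inE.
rewrite !truncE; case: leqP => leXk; last by rewrite !andbF.
rewrite !andbT => depX; apply/negP => /linear_matroidP indX.
have [B [BX indB spanB]] := exists_basis alpha X.
have ltBk : (#|B| <= k)%N.
  rewrite -ltnS (leq_trans _ leXk) // proper_card // finset.properEneq BX andbT.
  by apply: contraNneq depX => <-.
have [v vX] := dir B X indB ltBk spanB.
have [d [d_dep [i iX /eqP[]]]] := not_linear_matroid depX.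
apply: indX => //; rewrite sum_beta d_dep add0r.
have /lfunP/(_ v) := d_dep; rewrite sum_lfun_app lfunE /=.
by rewrite (eq_bigr (fun i => d i * lambda i)) => [->|s /vX-> //]; rewrite scale0r.
Qed.

End Perspectivity.

(** * The Jacobian ideal and its saturation *)

Section Jacobian.
Variables (K : fieldType) (l n : nat) (alpha : 'I_n -> dual K l).
Local Notation R := {mpoly K[l.+1]}.
Local Notation V := 'rV[K]_l.+1.
Local Notation Q := (defining_poly alpha).
Local Notation Qdiv := (defining_poly_div alpha).
Local Notation e j := (delta_mx 0 j : V).

Lemma mderiv_linform (a : dual K l) j : (linform a)^`M(j) = (a (e j))%:MP.
Proof.
rewrite /linform (big_morph _ (mderivD j) (mderiv0 _ j)) (bigD1 j) //= big1 ?addr0.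
  rewrite mderivZ mderivX mnm1E eqxx scale1r (_ : (U_(j) - U_(j))%MM = 0%MM).
    by rewrite mpolyX0 -mul_mpolyC mulr1.
  by apply/mnmP => s; rewrite mnmBE subnn mnm0E.
move=> i /negPf ij; rewrite mderivZ mderivX mnm1E ij.
by rewrite scale0r scaler0.
Qed.

Lemma mderiv_prod (I : eqType) (r : seq I) (F : I -> R) j : uniq r ->
  (\prod_(i <- r) F i)^`M(j) =
  \sum_(i <- r) (F i)^`M(j) * \prod_(k <- r | k != i) F k.
Proof.
elim: r => [_|i r IHr /= /andP[ir /IHr IH]].
  by rewrite !big_nil -mpolyC1 mderivC.
rewrite !big_cons mderivM IH eqxx; congr (_ * _ + _).
  rewrite big_seq [RHS]big_seq_cond; apply: eq_bigl => k; apply/idP/idP => [kr|/andP[] //].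
  by rewrite kr; apply: contraNneq ir => <-.
rewrite mulr_sumr; apply: eq_big_seq => k kr; rewrite big_cons.
have -> : i != k by apply: contraNneq ir => ->.
by rewrite mulrCA.
Qed.

(** The product rule for the vector field [c]: the coefficient of [Qdiv i] is [alpha i] applied to
    [c]. *)
Lemma jacobian_combination (c : 'I_l.+1 -> R) :
  \sum_j c j * Q^`M(j) = \sum_i (\sum_j alpha i (e j) *: c j) * Qdiv i.
Proof.
transitivity (\sum_j \sum_i (alpha i (e j) *: c j) * Qdiv i).
  apply: eq_bigr => j _; rewrite mderiv_prod ?index_enum_uniq // mulr_sumr.
  by apply: eq_bigr => i _; rewrite mderiv_linform mulrA -mul_mpolyC [c j * _]mulrC.
by rewrite exchange_big; apply: eq_bigr => i _; rewrite mulr_suml.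
Qed.

Lemma jacobian_idealP p : jacobian_ideal alpha p <->
  exists c : 'I_l.+1 -> R, p = \sum_i (\sum_j alpha i (e j) *: c j) * Qdiv i.
Proof. by split=> -[c ->]; exists c; rewrite jacobian_combination. Qed.

Lemma jacobian_ideal_is_ideal : is_ideal (jacobian_ideal alpha).
Proof.
split; first by exists (fun _ => 0); rewrite big1 // => j _; rewrite mul0r.
move=> a _ _ [c ->] [d ->]; exists (fun j => a * c j + d j).
rewrite mulr_sumr -big_split; apply: eq_bigr => j _.
by rewrite mulrDl mulrA.
Qed.

Lemma jacobian_ideal_directional (v : V) :
  jacobian_ideal alpha (\sum_i alpha i v *: Qdiv i).
Proof.
apply/jacobian_idealP; exists (fun j => (v 0 j)%:MP); apply: eq_bigr => i _.
rewrite -mul_mpolyC dual_app rmorph_sum /=; congr (_ * _); apply: eq_bigr => j _.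
by rewrite -mul_mpolyC mpolyCM.
Qed.

Lemma defining_polyD1 i : Q = linform (alpha i) * Qdiv i.
Proof. by rewrite /defining_poly (bigD1 i). Qed.

(* Euler's identity; for [n = 0] the ideal is zero but [Q = 1]. *)
Lemma jacobian_ideal_defining_poly :
  [pchar K] =i pred0 -> (0 < n)%N -> jacobian_ideal alpha Q.
Proof.
move=> /pcharf0P char0 n0; apply/jacobian_idealP.
exists (fun j => n%:R^-1 *: 'X_j).
transitivity (\sum_(i < n) n%:R^-1 *: Q); last first.
  apply: eq_bigr => i _; rewrite (defining_polyD1 i) scalerAl; congr (_ * _).
  by rewrite scaler_sumr; apply: eq_bigr => j _; rewrite !scalerA mulrC.
by rewrite sumr_const card_ord -scaler_nat scalerA divff ?scale1r // char0 -lt0n.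
Qed.

End Jacobian.

(** * Saturation of the Jacobian ideal and local directional derivatives *)

Section Saturation.
Variables (K : fieldType) (l n k : nat).
Variables (alpha : 'I_n -> dual K l) (lambda : 'I_n -> K).
Hypothesis char0 : [pchar K] =i pred0.
Hypothesis arr : is_arrangement alpha.
Local Notation R := {mpoly K[l.+1]}.
Local Notation V := 'rV[K]_l.+1.
Local Notation Q := (defining_poly alpha).
Local Notation Qdiv := (defining_poly_div alpha).
Local Notation e j := (delta_mx 0 j : V).
Local Notation vanishing_on U := (vanishing_ideal (fun w : V => w \in U)).

Let f : R := \sum_i lambda i *: Qdiv i.

Lemma vanishing_on_prime (U : {vspace V}) : is_prime_ideal (vanishing_on U).
Proof.
apply: vanishing_ideal_prime => //; first exact: mem0v.
by move=> w1 w2 t U1 U2; rewrite rpredD ?rpredZ ?rpredB.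
Qed.

(* Restricting the relation to the hyperplane [alpha i = 0] leaves only its
   [i]-th term. *)
Lemma defining_poly_div_relation (kappa : 'I_n -> R) i :
  \sum_j kappa j * Qdiv j = 0 -> vanishing_on (lker (alpha i)) (kappa i).
Proof.
have prH := vanishing_on_prime (lker (alpha i)).
have [idH _ prodH] := (is_prime_idealP _).1 prH.
have alphaH : vanishing_on (lker (alpha i)) (linform (alpha i)).
  by move=> w; rewrite memv_ker meval_linform => /eqP.
rewrite (bigD1 i) //= => /eqP; rewrite addr_eq0 => /eqP rel.
have : vanishing_on (lker (alpha i)) (kappa i * Qdiv i).
  rewrite rel; apply/(is_idealN idH)/(is_ideal_sum idH) => j ji.
  apply: (is_idealMl idH); rewrite /defining_poly_div (bigD1 i) 1?eq_sym //=.
  exact: (is_idealMr idH).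
case/prodH => // /(prime_prod prH)[j [_ ji aj]]; case/eqP: ji.
apply: arr.2; apply/esym/lker_sub_eq; last exact: arr.1.
by apply/subvP => w /aj; rewrite meval_linform memv_ker => ->.
Qed.

(** A prime chain ending inside the ideal of a subspace is no longer than the codimension, here at
    most [#|B|]. *)
Lemma height_le_flat_space (B : {set 'I_n}) (P : set R) : (#|B| <= k)%N ->
  (P `<=` vanishing_on (flat_space alpha B))%classic -> height_le P k.
Proof.
move=> leBk PB m C prC CS Cmax; apply: leq_trans leBk.
have := vanishing_ideal_height char0 prC CS; rewrite Cmax => /(_ _ PB) lem.
rewrite -(leq_add2l (\dim (flat_space alpha B))) (leq_trans _ (dim_flat_space alpha B)) //.
by rewrite addnC.
Qed.

Lemma codim_saturation_directional :
  codim_saturation (jacobian_ideal alpha) k f -> locally_directional k alpha lambda.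
Proof.
case=> m [D [[prD DJ] lowD]] B Y indB leBk spanY.
set W := flat_space alpha B; have prW := vanishing_on_prime W.
have [_ W1 _] := (is_prime_idealP _).1 prW.
have idD i : is_ideal (D i) by have [/idealr_closedP[]] := prD i.
(* Components of height at most [k] contain [f], so [g = 1] works. Any other has an element not
   vanishing on [W]: otherwise its radical would lie in the prime ideal of [W] and have height at
   most [k]. *)
have /choice[g gP] i : exists g, D i (f * g) /\ ~ vanishing_on W g.
  have [low|high] := pselect (height_le (radical (D i)) k).
    by exists 1; rewrite mulr1; split=> //; apply: lowD.
  suff /existsNP[g /not_implyP[Dg Wg]] : ~ (D i `<=` vanishing_on W)%classic.
    by exists g; split=> //; apply: is_idealMl.
  move=> DW; apply: high; apply: height_le_flat_space leBk _ => p [s Dps].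
  exact: (prime_exp prW) (DW _ Dps).
pose G := \prod_i g i.
have WG : ~ vanishing_on W G.
  by move=> /(prime_prod prW)[i [_ _]]; have [] := gP i.
have /DJ/jacobian_idealP[c fG] : forall i, D i (f * G).
  by move=> i; rewrite /G (bigD1 i) //= mulrA; apply: is_idealMr; have [] := gP i.
have /existsNP[w /not_implyP[Ww /eqP Gw]] := WG.
(* The direction is the field [c] at [w], scaled by the value of [G]: then [alpha i u = lambda i]
   says that [kappa i] below vanishes at [w]. *)
pose u := G.@[w 0]^-1 *: \row_j (c j).@[w 0].
exists u => i iY; have [d dE] := spanY i iY.
have iw : alpha i w = 0 := span_vanish dE Ww.
pose kappa i := lambda i *: G - \sum_j alpha i (e j) *: c j.
have /(@defining_poly_div_relation kappa i)/(_ w) : \sum_j kappa j * Qdiv j = 0.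
  rewrite /kappa; under eq_bigr do rewrite mulrBl.
  rewrite sumrB -fG /f mulr_suml; apply/eqP; rewrite subr_eq0; apply/eqP.
  by apply: eq_bigr => j _; rewrite -!scalerAl mulrC.
rewrite memv_ker iw eqxx => /(_ isT) /eqP.
rewrite /kappa mevalB mevalZ (big_morph _ (mevalD _) (meval0 _)) subr_eq0 => /eqP lamG.
apply: (mulIf Gw); rewrite lamG /u linearZ /= -[_ *: _]/(_ * _) dual_app mulrAC mulVf // mul1r.
by apply: eq_bigr => j _; rewrite mxE mevalZ.
Qed.

Lemma directional_codim_saturation :
  locally_directional k alpha lambda -> codim_saturation (jacobian_ideal alpha) k f.
Proof.
move=> dir.
have [m [D [prD DJ]]] := lasker_noether (jacobian_ideal_is_ideal alpha).
exists m, D; split=> // i htP; set P := radical (D i) in htP.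
have prP : is_prime_ideal P := radical_prime (prD i).
have [/idealr_closedP[idD _] primD] := prD i.
have JD p : jacobian_ideal alpha p -> D i p by move/DJ; apply.
pose X := [set j : 'I_n | `[< P (linform (alpha j)) >]].
have [B [BX indB spanX]] := exists_basis alpha X.
(* Independent linear forms in [P] cannot outnumber the bound on its height. *)
have leBk : (#|B| <= k)%N.
  have [v vE] := exists_dual_vectors indB.
  have [->|[b0 _]] := set_0Vmem B; first by rewrite cards0.
  pose b s := nth b0 (enum B) s.
  have bB s : (s < #|B|)%N -> b s \in B by move=> lt_s; rewrite -mem_enum mem_nth -?cardE.
  apply: (@dual_family_height K l char0 P (alpha \o b) (v \o b) #|B| k) => //.
    move=> s t lt_s lt_t /=; rewrite vE ?bB //.
    by rewrite nth_uniq ?enum_uniq -?cardE.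
  by move=> s /bB/(fintype.subsetP BX); rewrite inE => /asboolP.
have [v vX] := dir B X indB leBk spanX.
(* Subtracting the derivative of [Q] along [v] from [f] cancels the terms in [X]; each remaining
   [Qdiv j] is a multiple of [QX]. *)
suff DQ j : j \notin X -> D i (Qdiv j).
  rewrite (_ : f = \sum_j alpha j v *: Qdiv j + \sum_j (lambda j - alpha j v) *: Qdiv j).
    apply: is_idealD => //; first exact/JD/jacobian_ideal_directional.
    apply: is_ideal_sum => // j _; have [jX|jX] := boolP (j \in X).
      by rewrite vX // subrr scale0r; apply: is_ideal0.
    by rewrite -mul_mpolyC; apply: is_idealMl => //; apply: DQ.
  by rewrite -big_split; apply: eq_bigr => j _ /=; rewrite -scalerDl subrKC.
move=> jX; pose QX := \prod_(s in X) linform (alpha s).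
have DQX : D i QX.
  have : D i (QX * \prod_(s | s \notin X) linform (alpha s)).
    have -> : QX * \prod_(s | s \notin X) linform (alpha s) = Q.
      by rewrite /defining_poly [RHS](bigID (mem X)).
    (* The index [j] witnesses [0 < n], which Euler's identity requires. *)
    apply/JD/jacobian_ideal_defining_poly => //.
    by apply: leq_ltn_trans (ltn_ord j).
  case/primD => // PX; have /(prime_prod prP)[s [_ sX Ps]] : P _ := PX.
  by case/negP: sX; rewrite inE; apply/asboolP.
rewrite /defining_poly_div (bigID (mem X)) /=; apply: is_idealMr => //.
rewrite (eq_bigl (mem X)) // => s /=; apply: andb_idl => sX.
by apply: contraNneq jX => <-.
Qed.

End Saturation.

Theorem theorem6p2 (K : fieldType) (l n k : nat)
    (alpha : 'I_n -> dual K l) (alpha0 : dual K l) (lambda : 'I_n -> K) :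
  [pchar K] =i pred0 ->
  is_arrangement alpha ->
  (2 <= k <= l)%N ->
  alpha0 != 0 ->
  general_linear_position k.+1 alpha0 alpha ->
  codim_saturation (jacobian_ideal alpha) k
    (\sum_i lambda i *: defining_poly_div alpha i)
  <->
  weak_perspective_representation k.+1 alpha0 alpha
    (fun i => alpha i + lambda i *: alpha0).
Proof.
move=> char0 arr le_kl _ glp; split=> [sat|[_ weak _]].
  split=> //; last exact: perspective_beta arr le_kl glp.
  apply: directional_weak_representation.
  exact: codim_saturation_directional char0 arr sat.
apply: directional_codim_saturation => //.
exact: weak_representation_directional le_kl glp weak.
Qed.
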